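(* Let $q$ be a prime power and let $\mathcal{M}$ be a class of simple $GF(q)$-representable matroids that is closed under taking induced minors. Let $\widehat{\mathcal{M}}$ be the class of matroids consisting of the members of $\mathcal{M}$ together with all matroids obtainable from members of $\mathcal{M}$ by repeatedly taking $q$-conings. Then $\widehat{\mathcal{M}}$ is closed under taking induced minors.
   Context: All matroids are simple; every contraction is immediately followed by simplification. An induced minor of $M$ is a matroid obtained from $M$ by a sequence of restrictions to flats and contractions (each contraction followed by simplification). For a simple $GF(q)$-representable matroid $N$ (viewed as a restriction of a projective geometry over $GF(q)$), its $q$-coning $A(N)$ is the $GF(q)$-representable matroid obtained by adding a coloop $p$ (the tip) to $N$ and then adding every point on each projective line between $p$ and a point of $N$. *)

(* Defs.v *)
From HB Require Import structures.
From mathcomp Require Import all_boot all_order all_algebra.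

Set Implicit Arguments.
Unset Strict Implicit.
Unset Printing Implicit Defensive.

Import GRing.Theory.

(* The ground set of a matroid is the whole of the finite type T. *)
Record matroid (T : finType) : Type := Matroid {
  indep : {set T} -> bool;
  indep0 : indep set0;
  indepS : forall A B : {set T}, A \subset B -> indep B -> indep A;
  indep_aug : forall A B : {set T}, indep A -> indep B -> #|A| < #|B| ->
    exists2 x, x \in B :\: A & indep (x |: A)
}.

Section Basics.
Variables (T : finType) (M : matroid T).

Definition mrank (X : {set T}) : nat :=
  \max_(A : {set T} | (A \subset X) && indep M A) #|A|.

Definition mclosure (X : {set T}) : {set T} :=
  [set x | mrank (x |: X) == mrank X].

Definition flat (X : {set T}) : bool := mclosure X == X.

Definition loop (x : T) : bool := ~~ indep M [set x].

(* Reflexive on non-loops, so that its classes are the parallel classes. *)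
Definition parallel (x y : T) : bool :=
  [&& ~~ loop x, ~~ loop y & (x == y) || ~~ indep M [set x; y]].

Definition simple : Prop :=
  (forall x, ~~ loop x) /\ (forall x y, parallel x y -> x = y).

Lemma indep_leq_mrank (A X : {set T}) :
  A \subset X -> indep M A -> #|A| <= mrank X.
Proof.
move=> sAX iA.
by apply: (@leq_bigmax_cond _ _ (fun A : {set T} => #|A|)); rewrite sAX.
Qed.

Lemma mrank_leq (X : {set T}) n :
  (forall A : {set T}, A \subset X -> indep M A -> #|A| <= n) -> mrank X <= n.
Proof. by move=> le; apply/bigmax_leqP => A /andP[]; apply: le. Qed.

Lemma mrank_witness (X : {set T}) :
  exists B : {set T}, [/\ B \subset X, indep M B & #|B| = mrank X].
Proof.
have P0 : (set0 \subset X) && indep M set0 by rewrite sub0set indep0.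
rewrite /mrank (bigmax_eq_arg set0) //.
by case: arg_maxnP => // B /andP[sBX iB] _; exists B.
Qed.

Lemma indep_extend (B X : {set T}) : B \subset X -> indep M B ->
  exists I : {set T}, [/\ B \subset I, I \subset X, indep M I & #|I| = mrank X].
Proof.
have [k] := ubnP (mrank X - #|B|); elim: k B => // k IHk B ltk sBX iB.
have [ltB|geB] := ltnP #|B| (mrank X); last first.
  by exists B; split=> //; apply/eqP; rewrite eqn_leq geB indep_leq_mrank.
have [J [sJX iJ cJ]] := mrank_witness X.
have [|x /setDP[xJ xB] iBx] := indep_aug iB iJ; first by rewrite cJ.
have [||| I [sBI sIX iI cI]] := IHk (x |: B).
- rewrite cardsU1 xB addnC addn1 subnS.
  by rewrite -ltnS (leq_trans _ ltk) // ltnS prednK // subn_gt0.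
- by rewrite subUset sub1set (subsetP sJX).
- by [].
by exists I; split=> //; apply: subset_trans sBI; apply: subsetUr.
Qed.

Lemma mrank_contractE (B C A : {set T}) :
  B \subset C -> indep M B -> #|B| = mrank C -> [disjoint A & C] ->
  (mrank (A :|: C) == #|A| + mrank C) = indep M (A :|: B).
Proof.
move=> sBC iB cB dAC.
have dAB : [disjoint A & B] by apply: disjointWr dAC.
have cAB : #|A :|: B| = #|A| + #|B|.
  by rewrite cardsU (disjoint_setI0 dAB) cards0 subn0.
have [I [sBI sI iI cI]] : exists I : {set T},
    [/\ B \subset I, I \subset A :|: C, indep M I & #|I| = mrank (A :|: C)].
  by apply: indep_extend => //; apply: subset_trans sBC (subsetUr _ _).
have IC : I :&: C = B.
  apply/esym/eqP; rewrite eqEcard subsetI sBI sBC /= cB.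
  by apply: indep_leq_mrank; rewrite ?subsetIr //; apply: indepS iI; apply: subsetIl.
have sIAB : I \subset A :|: B.
  apply/subsetP => x xI; have /setUP[xA|xC] := subsetP sI x xI.
    by rewrite inE xA.
  by rewrite -IC !inE xI xC orbT.
apply/eqP/idP => [rE|iAB].
  have <- : I = A :|: B by apply/eqP; rewrite eqEcard sIAB cAB cI rE cB /=.
  exact: iI.
apply/eqP; rewrite eqn_leq -cI -cB -cAB subset_leq_card //=.
by rewrite cI indep_leq_mrank // setUS.
Qed.

Section Restriction.
Variable X : {set T}.
Let E : finType := {x : T | x \in X}.

Definition restrict_indep (A : {set E}) : bool := indep M (val @: A).

Lemma restrict_indep0 : restrict_indep set0.
Proof. by rewrite /restrict_indep imset0 indep0. Qed.

Lemma restrict_indepS (A B : {set E}) :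
  A \subset B -> restrict_indep B -> restrict_indep A.
Proof. by move=> sAB; apply: indepS; apply: imsetS. Qed.

Lemma restrict_indep_aug (A B : {set E}) :
  restrict_indep A -> restrict_indep B -> #|A| < #|B| ->
  exists2 x, x \in B :\: A & restrict_indep (x |: A).
Proof.
move=> iA iB ltAB; have := indep_aug iA iB.
rewrite !(card_imset _ val_inj) => /(_ ltAB)[_ /setDP[/imsetP[x xB ->] xA] ix].
exists x; first by rewrite inE xB -(mem_imset _ _ val_inj) xA.
by rewrite /restrict_indep imsetU1.
Qed.

Definition restrict : matroid E :=
  Matroid restrict_indep0 restrict_indepS restrict_indep_aug.

End Restriction.

Section Contraction.
Variable C : {set T}.
Let E : finType := {x : T | x \notin C}.

(* A is independent in M / C iff r_{M/C}(A) = r(A :|: C) - r(C) equals #|A|. *)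
Definition contract_indep (A : {set E}) : bool :=
  mrank (val @: A :|: C) == #|A| + mrank C.

Lemma contract_indepE (B : {set T}) :
  B \subset C -> indep M B -> #|B| = mrank C ->
  forall A, contract_indep A = indep M (val @: A :|: B).
Proof.
move=> sBC iB cB A; rewrite /contract_indep -(mrank_contractE sBC iB cB).
  by rewrite (card_imset _ val_inj).
by apply/pred0P => x /=; apply/negP => /andP[/imsetP[y _ ->]]; rewrite (negPf (valP y)).
Qed.

Lemma contract_indep0 : contract_indep set0.
Proof. by rewrite /contract_indep imset0 set0U cards0. Qed.

Lemma contract_indepS (A B : {set E}) :
  A \subset B -> contract_indep B -> contract_indep A.
Proof.
have [D [sDC iD cD]] := mrank_witness C.
rewrite !(contract_indepE sDC iD cD) => sAB; apply: indepS.
by apply: setSU; apply: imsetS.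
Qed.

Lemma contract_indep_aug (A B : {set E}) :
  contract_indep A -> contract_indep B -> #|A| < #|B| ->
  exists2 x, x \in B :\: A & contract_indep (x |: A).
Proof.
have [D [sDC iD cD]] := mrank_witness C.
have cU (G : {set E}) : #|val @: G :|: D| = #|G| + #|D|.
  rewrite cardsU (card_imset _ val_inj) [_ :&: _](_ : _ = set0) ?cards0 ?subn0 //.
  apply/eqP; rewrite -subset0; apply/subsetP => x /setIP[/imsetP[y _ ->] yD].
  by have := valP y; rewrite (subsetP sDC).
rewrite !(contract_indepE sDC iD cD) => iA iB ltAB.
have [|x] := indep_aug iA iB; first by rewrite !cU ltn_add2r.
rewrite !inE negb_or => /andP[/andP[xA xD]]; rewrite (negPf xD) orbF.
case/imsetP=> y yB def_x ix; exists y.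
  by rewrite inE yB andbT -(mem_imset _ _ val_inj) -def_x.
by rewrite (contract_indepE sDC iD cD) imsetU1 -setUA -def_x.
Qed.

Definition contract : matroid E :=
  Matroid contract_indep0 contract_indepS contract_indep_aug.

End Contraction.

(* Restricting to such a set deletes every loop and all but one element of each
   parallel class. *)
Definition simplifying_set (X : {set T}) : Prop :=
  (forall x, x \in X -> ~~ loop x) /\
  (forall x, ~~ loop x -> exists! y, y \in X /\ parallel x y).

End Basics.

Definition isomorphic (T U : finType) (M : matroid T) (N : matroid U) : Prop :=
  exists2 f : T -> U,
    bijective f & forall A : {set T}, indep N (f @: A) = indep M A.

(* Simplification is only defined up to the choice of representatives, and
   minors are taken up to isomorphism. *)
Inductive induced_minor (T : finType) (M : matroid T) :
    forall U : finType, matroid U -> Prop :=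
| InducedMinor_refl : induced_minor M M
| InducedMinor_iso (U V : finType) (N : matroid U) (P : matroid V) :
    induced_minor M N -> isomorphic N P -> induced_minor M P
| InducedMinor_restrict (U : finType) (N : matroid U) (X : {set U}) :
    induced_minor M N -> flat N X -> induced_minor M (restrict N X)
| InducedMinor_contract (U : finType) (N : matroid U) (C : {set U})
    (X : {set {x : U | x \notin C}}) :
    induced_minor M N -> simplifying_set (contract N C) X ->
    induced_minor M (restrict (contract N C) X).

Definition matroid_class : Type := forall T : finType, matroid T -> Prop.

(* By InducedMinor_iso such a class is in particular closed under isomorphism. *)
Definition induced_minor_closed (K : matroid_class) : Prop :=
  forall (T U : finType) (M : matroid T) (N : matroid U),
    K T M -> induced_minor M N -> K U N.

Definition represents (F : finFieldType) (T : finType) (n : nat)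
    (v : T -> 'rV[F]_n) (M : matroid T) : Prop :=
  forall A : {set T}, indep M A = free [seq v x | x in A].

Definition representable (F : finFieldType) (T : finType) (M : matroid T) :
    Prop :=
  exists n : nat, exists v : T -> 'rV[F]_n, represents v M.

(* The points of PG(n-1, F) are the lines <[u]> with u != 0 in F^n, so v embeds
   the simple matroid N in PG(n-1, F).  The tip w p lies outside the span of N,
   i.e. p is a coloop of N + p, and the points of A are exactly w p together
   with those on a projective line <[w p]> + <[v x]> through the tip and a point
   of N.  As N may have inequivalent embeddings, this is a relation: A is the
   coning of N for some embedding. *)
Definition qconing (F : finFieldType) (T U : finType)
    (N : matroid T) (A : matroid U) : Prop :=
  [/\ simple N, simple A &
    exists n (v : T -> 'rV[F]_n) (w : U -> 'rV[F]_n) (p : U),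
      [/\ represents v N, represents w A,
          w p \notin <<[seq v x | x : T]>>%VS &
          forall u : 'rV[F]_n, u != 0%R ->
            (exists y : U, <[w y]>%VS = <[u]>%VS) <->
            (<[u]>%VS = <[w p]>%VS \/
             exists x : T, u \in (<[w p]> + <[v x]>)%VS)]].

Inductive coning_closure (F : finFieldType) (K : matroid_class) :
    forall T : finType, matroid T -> Prop :=
| ConingClosure_base (T : finType) (M : matroid T) :
    K T M -> coning_closure F K M
| ConingClosure_cone (T U : finType) (N : matroid T) (A : matroid U) :
    coning_closure F K N -> qconing F N A -> coning_closure F K A.

Definition prime_power (q : nat) : Prop :=
  exists p k : nat, [/\ prime p, 0 < k & q = p ^ k].

(* Main.v *)
Require Import Defs.
From HB Require Import structures.
From mathcomp Require Import all_boot all_order all_algebra.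

Set Implicit Arguments.
Unset Strict Implicit.
Unset Printing Implicit Defensive.

(* Let A be the coning of N with tip p, all inside one vector space, and let W
   be the span of a set B of elements of A.  The shadow of W is the set of
   elements of N whose vectors lie in W + <p>, so that projecting from p maps W
   onto the span of the shadow.  If X is a flat of A with span W, then A|X is the
   coning of N|shadow when p is in X, and projecting from p gives
   A|X = N|shadow otherwise.  Dually, modulo W, si(A/B) is si(N/shadow) when p
   is in W, and the coning of si(N/shadow) otherwise.  Hence the closure of K
   under conings is stable under both operations, by induction on the conings. *)

Import GRing.Theory.

(** * Spans of vector families, lines, and quotient maps *)

Section Spans.
Variables (F : finFieldType) (n : nat).
Implicit Types (u z : 'rV[F]_n) (W V : {vspace 'rV[F]_n}).

Definition sp (T : finType) (v : T -> 'rV[F]_n) (A : {set T}) :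
  {vspace 'rV[F]_n} := (\sum_(x in A) <[v x]>)%VS.

(* Stands for the quotient map by W: an idempotent endomorphism with kernel W. *)
Definition quo W : 'End('rV[F]_n) := (\1%VF - projv W)%R.

Lemma eq_line u z : u != 0%R -> u \in <[z]>%VS -> <[u]>%VS = <[z]>%VS.
Proof.
move=> u0 uz; apply/eqP; rewrite eqEdim -memvE uz !dim_vline u0.
by case: (z != 0%R).
Qed.

Lemma line_neq0 u z : u != 0%R -> <[u]>%VS = <[z]>%VS -> z != 0%R.
Proof.
by move=> u0 e; have := dim_vline u; rewrite e dim_vline u0; case: (z != 0%R).
Qed.

(** The coefficient of [a] in [u] is nonzero, as otherwise [u] would lie on the line of [z]; so the
    relation can be solved for [a]. Below, [z] is the tip, and this swaps a point of the coning with
    the base point beneath it. *)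
Lemma line_exchange u z a :
  u \in (<[z]> + <[a]>)%VS -> u \notin <[z]>%VS -> a \in (<[z]> + <[u]>)%VS.
Proof.
case/memv_addP=> _ /vlineP[c ->] [_ /vlineP[d ->]] -> uz.
have d0 : d != 0%R.
  by apply: contraNneq uz => ->; rewrite scale0r addr0 memvZ ?memv_line.
have {1}-> : (a = (- (d^-1 * c)) *: z + d^-1 *: (c *: z + d *: a))%R.
  by rewrite scalerDr !scalerA mulVf // scale1r scaleNr addKr.
by apply: memv_add; apply: memvZ; apply: memv_line.
Qed.

Lemma line_map (f : 'End('rV[F]_n)) u z :
  <[u]>%VS = <[z]>%VS -> <[f u]>%VS = <[f z]>%VS.
Proof. by rewrite -!limg_line => ->. Qed.

Lemma quo_sub W u : (u - quo W u)%R \in W.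
Proof.
by rewrite /quo add_lfunE opp_lfunE id_lfunE opprB addrC subrK memv_proj.
Qed.

Lemma lker_quo W : lker (quo W) = W.
Proof.
apply/vspaceP => u; apply/idP/idP => [/[!memv_ker] /eqP q0|uW].
  by have := quo_sub W u; rewrite q0 subr0.
by rewrite memv_ker /quo add_lfunE opp_lfunE id_lfunE projv_id // subrr.
Qed.

Lemma quo_eq0 W u : (quo W u == 0)%R = (u \in W).
Proof. by rewrite -memv_ker lker_quo. Qed.

Lemma quo_idem W u : quo W (quo W u) = quo W u.
Proof.
apply/esym/eqP; rewrite -subr_eq0 -linearB /= quo_eq0.
exact: quo_sub.
Qed.

(** [u] and [quo W u] differ by an element of [W]. *)
Lemma quo_add W u : (W + <[quo W u]> = W + <[u]>)%VS.
Proof.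
have qW := quo_sub W u; apply: subv_anti; rewrite !subv_add !addvSl /=.
apply/andP; split; rewrite -memvE.
  rewrite -[quo W u](subKr u) addrC; apply: memv_add; last exact: memv_line.
  by rewrite memvN.
by rewrite -[X in X \in _](subrK (quo W u)) memv_add ?memv_line.
Qed.

Lemma line0 : <[0%R : 'rV[F]_n]>%VS = 0%VS.
Proof. by apply/eqP; rewrite -dimv_eq0 dim_vline eqxx. Qed.

Lemma img_add_line (f : 'End('rV[F]_n)) u z a :
  u \in (<[z]> + <[a]>)%VS -> f u \in (<[f z]> + <[f a]>)%VS.
Proof. by move/(memv_img f); rewrite limgD !limg_line. Qed.

Lemma cap_line0 W z : z \notin W -> (W :&: <[z]>)%VS = 0%VS.
Proof.
move=> zW; apply/eqP; rewrite -subv0; apply/subvP => u /memv_capP[uW uz].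
rewrite memv0; apply: contraNT zW => u0.
by rewrite memvE -(eq_line u0 uz) -memvE.
Qed.

Section Family.
Variables (T : finType) (v : T -> 'rV[F]_n).
Implicit Types (A B : {set T}).

Lemma mem_sp A x : x \in A -> v x \in sp v A.
Proof. by move=> xA; rewrite memvE (sumv_sup x). Qed.

Lemma sp_sub A W : (forall x, x \in A -> v x \in W) -> (sp v A <= W)%VS.
Proof. by move=> h; apply/subv_sumP => x /h; rewrite memvE. Qed.

Lemma sp_subset A B : A \subset B -> (sp v A <= sp v B)%VS.
Proof. by move=> sAB; apply: sp_sub => x /(subsetP sAB); apply: mem_sp. Qed.

Lemma sp1 x : sp v [set x] = <[v x]>%VS.
Proof. by rewrite /sp big_set1. Qed.

Lemma spU A B : sp v (A :|: B) = (sp v A + sp v B)%VS.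
Proof.
apply: subv_anti; apply/andP; split.
  apply: sp_sub => x /setUP[/mem_sp|/mem_sp]; apply: subvP.
    exact: addvSl.
  exact: addvSr.
by rewrite subv_add !sp_subset ?subsetUl ?subsetUr.
Qed.

Lemma span_sp A : <<[seq v x | x in A]>>%VS = sp v A.
Proof. by rewrite span_def big_map big_enum. Qed.

Lemma span_spT : <<[seq v x | x : T]>>%VS = sp v setT.
Proof.
rewrite -span_sp; congr <<_>>%VS; apply: eq_image => // x.
by rewrite in_setT.
Qed.

Lemma dim_sp_leq A : \dim (sp v A) <= #|A|.
Proof. by rewrite -span_sp (leq_trans (dim_span _)) // size_map -cardE. Qed.

Lemma free_sp A : free [seq v x | x in A] = (\dim (sp v A) == #|A|).
Proof. by rewrite /free span_sp size_map -cardE. Qed.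

Lemma limg_sp (f : 'End('rV[F]_n)) A : (f @: sp v A)%VS = sp (f \o v) A.
Proof. by rewrite limg_sum; apply: eq_bigr => x _; rewrite limg_line. Qed.

Lemma sp_imset (U : finType) (g : U -> T) (A : {set U}) :
  injective g -> sp v (g @: A) = sp (v \o g) A.
Proof. by move=> g_inj; rewrite /sp big_imset //; apply: in2W. Qed.

End Family.
End Spans.

(** * Matroid notions expressed through a representation *)

Section Representation.
Variables (F : finFieldType) (n : nat) (T : finType) (M : matroid T).
Variables (v : T -> 'rV[F]_n) (rep : represents v M).

Lemma indep_dim A : indep M A = (\dim (sp v A) == #|A|).
Proof. by rewrite rep free_sp. Qed.

(** A largest independent subset [B] of [X] spans all vectors of [X]: an element outside its span
    could be added to [B], giving a larger independent subset of [X]. *)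
Lemma mrank_dim X : mrank M X = \dim (sp v X).
Proof.
apply/eqP; rewrite eqn_leq; apply/andP; split.
  apply: mrank_leq => A sAX; rewrite indep_dim => /eqP <-.
  exact/dimvS/sp_subset.
have [B [sBX iB cB]] := mrank_witness M X.
have dB : \dim (sp v B) = #|B| by apply/eqP; rewrite -indep_dim.
rewrite -cB -dB; apply/dimvS/sp_sub => x xX; apply: contraT => xB.
have xNB : x \notin B by apply: contra xB; apply: mem_sp.
have cxB : #|x |: B| = #|B|.+1 by rewrite cardsU1 xNB.
have lt : \dim (sp v B) < \dim (sp v (x |: B)).
  rewrite ltn_neqAle dimvS ?sp_subset ?subsetUr // andbT.
  apply: contra xB => e.
  have -> : sp v B = sp v (x |: B).
    by apply/eqP; rewrite eqEdim sp_subset ?subsetUr //= (eqP e).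
  by rewrite mem_sp ?setU11.
have ixB : indep M (x |: B).
  by rewrite indep_dim eqn_leq dim_sp_leq cxB -dB.
suff: #|x |: B| <= mrank M X by rewrite cxB cB ltnn.
by apply: indep_leq_mrank => //; rewrite subUset sub1set xX.
Qed.

Lemma mem_mclosure X x : (x \in mclosure M X) = (v x \in sp v X).
Proof.
rewrite inE !mrank_dim spU sp1; apply/idP/idP => [/eqP e|xX].
  have -> : sp v X = (<[v x]> + sp v X)%VS.
    by apply/eqP; rewrite eqEdim addvSr e /=.
  by rewrite memvE addvSl.
by move: xX; rewrite memvE => /addv_idPr ->.
Qed.

Lemma flatP X : reflect (forall x, v x \in sp v X -> x \in X) (flat M X).
Proof.
apply: (iffP eqP) => [e x|h]; first by rewrite -mem_mclosure e.
apply/setP => x; rewrite mem_mclosure.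
by apply/idP/idP => [/h|/(mem_sp v)].
Qed.

(** Used to see that every shadow is a flat of the base. *)
Lemma flat_preim (W : {vspace 'rV[F]_n}) : flat M [set x | v x \in W].
Proof.
apply/flatP => x h; rewrite inE; apply: subvP h.
by apply: sp_sub => y; rewrite inE.
Qed.

Lemma represents_restrict X : represents (fun x => v (val x)) (restrict M X).
Proof.
move=> A; rewrite free_sp /= /restrict_indep indep_dim sp_imset; last exact: val_inj.
by rewrite (card_imset _ val_inj).
Qed.

(** The hypothesis makes [f] injective on the span of the matroid, so dimensions of spans are
    preserved. *)
Lemma represents_map (f : 'End('rV[F]_n)) :
  (sp v setT :&: lker f)%VS = 0%VS -> represents (fun x => f (v x)) M.
Proof.
move=> k0 A; rewrite free_sp -(limg_sp v f) limg_dim_eq ?indep_dim //.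
apply/eqP; rewrite -subv0 -k0 capvS //; exact/sp_subset/subsetT.
Qed.

(** Rank-nullity for [f] on the span of [A] and [C]. The kernel of [f] need only agree with [sp v C]
    inside the span of the matroid; this freedom allows a kernel containing the tip when the base of
    a coning is contracted. *)
Lemma represents_contract (f : 'End('rV[F]_n)) (C : {set T}) :
  (sp v C <= lker f)%VS -> (sp v setT :&: lker f <= sp v C)%VS ->
  represents (fun x => f (v (val x))) (contract M C).
Proof.
move=> Cf fC A; rewrite free_sp /= /contract_indep !mrank_dim.
set S := sp v (_ :|: C).
have kS : (S :&: lker f)%VS = sp v C.
  apply: subv_anti; apply/andP; split.
    by apply: subv_trans fC; rewrite capvS ?sp_subset ?subsetT.
  by rewrite subv_cap Cf sp_subset ?subsetUr.
have iS : (f @: S)%VS = sp (fun x => f (v (val x))) A.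
  rewrite /S spU limgD; move: (Cf); rewrite lkerE => /eqP ->.
  by rewrite addv0 sp_imset ?limg_sp //; apply: val_inj.
by rewrite -(limg_ker_dim f S) kS iS addnC eqn_add2r.
Qed.

Lemma loopE x : loop M x = (v x == 0%R).
Proof.
by rewrite /loop indep_dim sp1 dim_vline cards1; case: (v x == 0%R).
Qed.

Lemma parallelE x y :
  parallel M x y = (v x != 0%R) && (<[v x]>%VS == <[v y]>%VS).
Proof.
rewrite /parallel !loopE; have [->|x0] //= := eqVneq (v x) 0%R.
have [->|y0] /= := eqVneq (v y) 0%R.
  by apply/esym/eqP => /(line_neq0 x0) /eqP.
have [->|xy] /= := eqVneq x y; first by rewrite eqxx.
rewrite indep_dim spU !sp1 cards2 xy; apply/idP/eqP => [d|->]; last first.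
  by rewrite addvv dim_vline y0.
have le2 : \dim (<[v x]> + <[v y]>) <= 2.
  by rewrite (leq_trans (dimv_add_leqif _ _)) // !dim_vline x0 y0.
have le1 : \dim (<[v x]> + <[v y]>) <= 1 by rewrite -ltnS ltn_neqAle d.
have ex : <[v x]>%VS = (<[v x]> + <[v y]>)%VS.
  by apply/eqP; rewrite eqEdim addvSl dim_vline x0.
have ey : <[v y]>%VS = (<[v x]> + <[v y]>)%VS.
  by apply/eqP; rewrite eqEdim addvSr dim_vline y0.
by rewrite ex -ey.
Qed.

Lemma simpleP : simple M <->
  (forall x, v x != 0%R) /\ (forall x y, <[v x]>%VS = <[v y]>%VS -> x = y).
Proof.
split=> [[nl np]|[nl np]].
  have nz x : v x != 0%R by rewrite -loopE.
  by split=> // x y e; apply: np; rewrite parallelE nz e eqxx.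
split=> x; first by rewrite loopE.
by move=> y; rewrite parallelE => /andP[_ /eqP]; apply: np.
Qed.

Lemma simplifying_set_exists : exists X, simplifying_set M X.
Proof.
(* The choice depends only on the line of [v x], so each parallel class has exactly one element that
   is its own representative. *)
pose r x := [pick y | <[v y]>%VS == <[v x]>%VS].
have rE x y : <[v x]>%VS = <[v y]>%VS -> r x = r y by rewrite /r => ->.
exists [set x | (v x != 0%R) && (r x == Some x)]; split=> x.
  by rewrite inE loopE => /andP[].
rewrite loopE => x0; case rx: (r x) => [y|]; last first.
  by move: rx; rewrite /r; case: pickP => // /(_ x); rewrite eqxx.
have exy : <[v x]>%VS = <[v y]>%VS.
  by move: rx; rewrite /r; case: pickP => // z /eqP e [<-].
exists y; split=> [|z []]; rewrite inE parallelE x0.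
  by rewrite (line_neq0 x0 exy) -(rE _ _ exy) rx exy !eqxx.
move=> /andP[_ /eqP rz] /eqP /rE; rewrite rx rz; congruence.
Qed.

End Representation.

(** * Simplifications and isomorphisms in terms of projective points *)

Lemma simplifying_setP (F : finFieldType) (n : nat) (T : finType) (M : matroid T)
    (v : T -> 'rV[F]_n) (X : {set T}) :
  represents v M -> simplifying_set M X ->
  simple (restrict M X) /\
  forall x, v x != 0%R ->
    exists y : {x | x \in X}, <[v (val y)]>%VS = <[v x]>%VS.
Proof.
move=> rep [nl ex]; split.
  apply/(simpleP (represents_restrict rep (X:=X))).
  split=> [x|x y exy]; first by rewrite -(loopE rep) nl ?(valP x).
  have nlx := nl _ (valP x); have [z [_ zP]] := ex _ nlx.
  apply: val_inj; rewrite -(zP (val x)); last first.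
    by rewrite (parallelE rep) -(loopE rep) nlx eqxx (valP x).
  by apply: zP; rewrite (parallelE rep) -(loopE rep) nlx exy eqxx (valP y).
move=> x x0; have [|y [[yX]]] := ex x; first by rewrite (loopE rep).
rewrite (parallelE rep) => /andP[_ /eqP ->] _; by exists (Sub y yX).
Qed.

(** The last clause can range over all of [T] because elements of [C] are sent to zero by [f]. It
    says that the simplification keeps every point of the image configuration. *)
Lemma simplify_contractP (F : finFieldType) (n : nat) (T : finType)
    (M : matroid T) (v : T -> 'rV[F]_n) (f : 'End('rV[F]_n)) (C : {set T})
    (X : {set {x | x \notin C}}) :
  represents v M -> (sp v C <= lker f)%VS ->
  (sp v setT :&: lker f <= sp v C)%VS -> simplifying_set (contract M C) X ->
  [/\ simple (restrict (contract M C) X),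
     represents (fun x : {x | x \in X} => f (v (val (val x))))
       (restrict (contract M C) X) &
     forall x, f (v x) != 0%R -> exists y : {x | x \in X},
       <[f (v (val (val y)))]>%VS = <[f (v x)]>%VS].
Proof.
move=> rv Cf fC sX; have rc := represents_contract rv Cf fC.
have [sM ex] := simplifying_setP rc sX; split=> //.
  exact: (represents_restrict rc).
move=> x x0; have [xC|xC] := boolP (x \in C); last exact: (ex (Sub x xC)).
case/negP: x0; rewrite -memv_ker; apply: subvP Cf _ _.
exact: mem_sp.
Qed.

(** By simplicity the two choices of a partner on the same line are mutually inverse, and
    independence depends only on the lines, not on the vectors spanning them. *)
Lemma same_points_isomorphic (F : finFieldType) (n : nat) (T U : finType)
    (M : matroid T) (N : matroid U) (v : T -> 'rV[F]_n) (w : U -> 'rV[F]_n) :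
  represents v M -> represents w N -> simple M -> simple N ->
  (forall x, exists y, <[w y]>%VS = <[v x]>%VS) ->
  (forall y, exists x, <[v x]>%VS = <[w y]>%VS) -> isomorphic M N.
Proof.
move=> rv rw /(simpleP rv)[_ iv] /(simpleP rw)[_ iw].
move=> /fin_all_exists[g gP] /fin_all_exists[h hP].
have gK : cancel g h by move=> x; apply: iv; rewrite hP gP.
have hK : cancel h g by move=> y; apply: iw; rewrite gP hP.
exists g; first by exists h.
move=> A; rewrite (indep_dim rw) (indep_dim rv) sp_imset; last exact: can_inj gK.
rewrite (card_imset _ (can_inj gK)); congr (\dim _ == _).
by apply: eq_bigr => x _; apply: gP.
Qed.

Lemma simple_restrict (T : finType) (M : matroid T) (X : {set T}) :
  simple M -> simple (restrict M X).
Proof.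
have loop_val (x : {x | x \in X}) : loop (restrict M X) x = loop M (val x).
  by rewrite /loop /= /restrict_indep imset_set1.
move=> [nl np]; split=> [x|x y]; first by rewrite loop_val.
rewrite /parallel !loop_val /= /restrict_indep imsetU1 imset_set1 => h.
exact/val_inj/np.
Qed.

(** * Flats and contractions of a single coning *)

Section Cone.
Variables (F : finFieldType) (n : nat) (T U : finType).
Variables (N : matroid T) (A : matroid U).
Variables (v : T -> 'rV[F]_n) (w : U -> 'rV[F]_n) (p : U).
Hypotheses (sN : simple N) (sA : simple A).
Hypotheses (rv : represents v N) (rw : represents w A).
Hypothesis tip : w p \notin <<[seq v x | x : T]>>%VS.
Hypothesis pts : forall u : 'rV[F]_n, u != 0%R ->
  (exists y : U, <[w y]>%VS = <[u]>%VS) <->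
  (<[u]>%VS = <[w p]>%VS \/ exists x : T, u \in (<[w p]> + <[v x]>)%VS).

Let nz_v x : v x != 0%R. Proof. by have [h _] := (simpleP rv).1 sN. Qed.
Let nz_w y : w y != 0%R. Proof. by have [h _] := (simpleP rw).1 sA. Qed.

Lemma base_point x : exists y, <[w y]>%VS = <[v x]>%VS.
Proof. by apply/pts => //; right; exists x; rewrite memvE addvSr. Qed.

Lemma cone_point y :
  <[w y]>%VS = <[w p]>%VS \/ exists x, w y \in (<[w p]> + <[v x]>)%VS.
Proof. by apply/pts => //; exists y. Qed.

(** A vector in the span of the base with a nonzero component along the tip would bring the tip into
    that span. *)
Lemma tip_cap W : (W <= sp v setT)%VS ->
  (sp v setT :&: (W + <[w p]>) = W)%VS.
Proof.
move=> sW; apply: subv_anti; apply/andP; split; last first.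
  by rewrite subv_cap sW addvSl.
apply/subvP => u /memv_capP[uV /memv_addP[a aW [b /vlineP[c ->] eu]]].
suff c0 : c = 0%R by rewrite eu c0 scale0r addr0.
apply: contraNeq tip => c0; rewrite span_spT.
have : (c *: w p)%R \in sp v setT.
  have -> : (c *: w p = u - a)%R by rewrite eu addrC addKr.
  by apply: memvB => //; apply: subvP aW.
by move/(memvZ c^-1%R); rewrite scalerA mulVf // scale1r.
Qed.

Definition shadow (W : {vspace 'rV[F]_n}) : {set T} :=
  [set x | v x \in (W + <[w p]>)%VS].

(** A point of [B] other than the tip lies on a line through the tip and some base point, and by
    exchange that base point belongs to the shadow. *)
Lemma shadow_sp (B : {set U}) :
  (sp v (shadow (sp w B)) + <[w p]> = sp w B + <[w p]>)%VS.
Proof.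
apply: subv_anti; rewrite !subv_add !addvSr !andbT; apply/andP; split.
  by apply: sp_sub => x; rewrite inE.
apply: sp_sub => y yB; have [e|[x xy]] := cone_point y.
  by rewrite memvE e addvSr.
have [yp|yp] := boolP (w y \in <[w p]>%VS).
  by apply: subvP yp; apply: addvSr.
have xW := line_exchange xy yp.
rewrite addvC; apply: subvP xy; apply: addvS => //.
rewrite -memvE mem_sp // inE; move: xW; rewrite addvC; apply: subvP; apply: addvS => //.
by rewrite -memvE mem_sp.
Qed.

Lemma cone_restrict (X : {set U}) : flat A X ->
  exists2 Y : {set T}, flat N Y &
    qconing F (restrict N Y) (restrict A X) \/
    isomorphic (restrict N Y) (restrict A X).
Proof.
move=> fX; exists (shadow (sp w X)); first exact: (flat_preim rv).
set W := sp w X; have inX y : w y \in W -> y \in X by move/(flatP rw): fX; apply.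
have [pX|pX] := boolP (p \in X).
  left; split; try exact: simple_restrict.
  exists n, (fun x => v (val x)), (fun y => w (val y)), (Sub p pX).
  split; try exact: represents_restrict.
    apply: contra tip; rewrite !span_spT /=; apply: subvP.
    by apply: sp_sub => x _; apply: mem_sp.
  have pW : w p \in W by apply: mem_sp.
  have WE : (W + <[w p]>)%VS = W by apply/addv_idPl; rewrite -memvE.
  move=> u u0; split=> /= [[y uy]|uy].
    have uW : u \in W by rewrite memvE -uy -memvE mem_sp ?(valP y).
    have [|up|[x ux]] := (pts u0).1; [by exists (val y)|by left|].
    have [up|up] := boolP (u \in <[w p]>%VS); first by left; apply: eq_line.
    right; have xW : x \in shadow W.
      rewrite inE; have := line_exchange ux up; rewrite addvC.
      by apply: subvP; apply: addvS => //; rewrite -memvE.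
    by exists (Sub x xW).
  (* As [W] contains the tip, the vectors of the shadow lie in [W] itself; flatness of [X] then
     places the point of [u] in [X]. *)
  have uW : u \in W.
    case: uy => [e|[x]]; first by rewrite memvE e -memvE.
    have := valP x; rewrite inE WE => xW.
    by apply: subvP; rewrite subv_add -!memvE pW.
  have [|y yu] := (pts u0).2.
    by case: uy => [e|[x ux]]; [left|right; exists (val x)].
  have yX : y \in X by apply: inX; rewrite memvE yu -memvE.
  by exists (Sub y yX).
(* The tip lies neither in the span of the base nor in [W], so [f] is injective on both; it remains
   to compare the projected points. *)
right; pose f := quo <[w p]>%VS.
have pW : w p \notin W by apply: contra pX; apply: inX.
have fp : f (w p) = 0%R by apply/eqP; rewrite quo_eq0 memv_line.
have notp y : y \in X -> w y \notin <[w p]>%VS.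
  move=> yX; apply: contra pW => /(eq_line (nz_w y)) e.
  by rewrite memvE -e -memvE mem_sp.
apply: (same_points_isomorphic (v := fun x => f (v (val x)))
  (w := fun y => f (w (val y)))); try exact: simple_restrict.
- have rfv : represents (fun x => f (v x)) N.
    by apply: represents_map; rewrite // lker_quo cap_line0 // -span_spT.
  exact: (represents_restrict rfv).
- apply: (represents_map (represents_restrict rw (X:=X))).
  rewrite lker_quo cap_line0 //; apply: contra pW; apply: subvP.
  by apply: sp_sub => y _; rewrite mem_sp ?(valP y).
(* The component [a] in [W] is nonzero, since [v x] is not on the tip line. It lies on the line
   through the tip and [v x], so it is a point of the coning, and it projects to the same vector as
   [v x]. *)
- move=> x; have := valP x; rewrite inE => /memv_addP[a aW [b bp eb]].
  have a0 : a != 0%R.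
    apply: contraNneq tip => a0; rewrite span_spT.
    move: bp; rewrite -[b]add0r -a0 -eb => /(eq_line (nz_v _)) e.
    by rewrite memvE -e -memvE mem_sp.
  have [|y ya] := (pts a0).2.
    right; exists (val x); have -> : a = (v (val x) - b)%R by rewrite eb addrK.
    by rewrite addrC memv_add ?memvN ?memv_line.
  have yX : y \in X by apply: inX; rewrite memvE ya -memvE.
  exists (Sub y yX); rewrite (line_map f ya) eb linearD /=.
  by move: bp; rewrite -quo_eq0 => /eqP; rewrite -/f => ->; rewrite addr0.
move=> y; have yX := valP y; have yp := notp _ yX.
have [e|[x xy]] := cone_point (val y).
  by case/negP: yp; rewrite -e memv_line.
have xW : x \in shadow W.
  rewrite inE; have := line_exchange xy yp; rewrite addvC.
  by apply: subvP; apply: addvS => //; rewrite -memvE mem_sp.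
exists (Sub x xW); apply/esym/eq_line; first by rewrite quo_eq0.
by have := img_add_line f xy; rewrite fp line0 add0v.
Qed.

Lemma cone_contract (C : {set U}) (X : {set {y | y \notin C}}) :
  simplifying_set (contract A C) X ->
  exists (D : {set T}) (Y : {set {x | x \notin D}}),
    simplifying_set (contract N D) Y /\
    (qconing F (restrict (contract N D) Y) (restrict (contract A C) X) \/
     isomorphic (restrict (contract N D) Y) (restrict (contract A C) X)).
Proof.
move=> sX; set W := sp w C; set D := shadow W; exists D.
(* N/D is represented by composing v with h rather than with f, so that the span
   of its vectors avoids the image f (w p) of the tip; both give the same lines
   through f (w p). *)
pose f := quo W; pose L := <[f (w p)]>%VS; pose h := (quo L \o f)%VF.
have hE u : h u = quo L (f u) by rewrite comp_lfunE.
have kf : lker f = W by apply: lker_quo.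
(* [h] kills [u] exactly when [f u] is a multiple of [f (w p)], that is, when [u] is a multiple of
   [w p] modulo [W]. *)
have kh : lker h = (W + <[w p]>)%VS.
  apply/vspaceP => u; rewrite memv_ker hE quo_eq0; apply/idP/idP.
    case/vlineP=> c fu; have -> : (u = (u - c *: w p) + c *: w p)%R by rewrite subrK.
    apply: memv_add; last by rewrite memvZ ?memv_line.
    by rewrite -kf memv_ker linearB linearZ /= fu subrr.
  case/memv_addP=> a; rewrite -kf memv_ker => /eqP fa [_ /vlineP[c ->] ->].
  by rewrite linearD linearZ /= fa add0r memvZ ?memv_line.
have DE : (sp v D + <[w p]> = W + <[w p]>)%VS by apply: shadow_sp.
have Dh : (sp v D <= lker h)%VS by rewrite kh -DE addvSl.
have hD : (sp v setT :&: lker h <= sp v D)%VS.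
  by rewrite kh -DE tip_cap ?sp_subset ?subsetT.
have Cf : (sp w C <= lker f)%VS by rewrite kf.
have fC : (sp w setT :&: lker f <= sp w C)%VS by rewrite kf capvSr.
have rcN := represents_contract rv Dh hD.
have [Y sY] := simplifying_set_exists rcN; exists Y; split=> //.
have [sN' rN' exN] := simplify_contractP rv Dh hD sY.
have [sA' rA' exA] := simplify_contractP rw Cf fC sX.
have [nzN _] := (simpleP rN').1 sN'; have [nzA _] := (simpleP rA').1 sA'.
have [pW|pW] := boolP (w p \in W).
  right; have fp : f (w p) = 0%R by apply/eqP; rewrite quo_eq0.
  (* Here [L] is the zero space, so [quo L] is the identity. *)
  have hf u : h u = f u.
    apply/eqP; rewrite hE eq_sym -subr_eq0 -memv0 -line0 -fp.
    exact: quo_sub.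
  apply: (same_points_isomorphic rN' rA') => // [x|y].
    have [y yx] := base_point (val (val x)); rewrite hf.
    have [|y' y'y] := exA y; last by exists y'; rewrite y'y (line_map f yx).
    apply: line_neq0 (esym (line_map f yx)); rewrite -hf.
    exact: nzN.
  have [e|[x xy]] := cone_point (val (val y)).
    have := line_map f e; rewrite fp => /(line_neq0 (nzA y)).
    by rewrite eqxx.
  have e : <[f (w (val (val y)))]>%VS = <[f (v x)]>%VS.
    apply: eq_line (nzA y) _.
    by have := img_add_line f xy; rewrite fp line0 add0v.
  rewrite e -hf; apply: exN; rewrite hf.
  exact: line_neq0 e.
have fp : f (w p) != 0%R by rewrite quo_eq0.
(* The tip of the new coning: the element kept by the simplification on the line of [f (w p)],
   possibly not [p] itself. *)
have [p' p'E] := exA p fp.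
have LE x : (L + <[h (v x)]> = L + <[f (v x)]>)%VS by rewrite hE quo_add.
left; split=> //; exists n, (fun x => h (v (val (val x)))),
  (fun y => f (w (val (val y)))), p'; split=> //.
  (* The base vectors all lie in the image of [quo L]. This map is idempotent, so it fixes its image
     and a vector of [L] there must vanish. *)
  apply: contra fp; rewrite span_spT => pN.
  have : f (w p) \in limg (quo L).
    rewrite memvE -p'E -memvE; apply: subvP pN.
    by apply: sp_sub => x _; rewrite hE memv_img ?memvf.
  case/memv_imgP=> t _ e; have : quo L (f (w p)) = 0%R.
    by apply/eqP; rewrite quo_eq0 memv_line.
  by rewrite [X in quo L X]e quo_idem -e => ->.
move=> u u0; rewrite p'E -/L; split=> [[y uy]|uL].
  have [e|[x xy]] := cone_point (val (val y)).
    by left; rewrite -uy (line_map f e).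
  have uL : u \in (L + <[h (v x)]>)%VS.
    by rewrite LE memvE -uy -memvE; apply: img_add_line.
  (* If [x] becomes a loop in the contracted base, its line through the tip collapses to the tip. *)
  have [h0|h0] := eqVneq (h (v x)) 0%R.
    by left; apply: eq_line => //; rewrite h0 line0 addv0 in uL.
  by right; have [x' x'E] := exN _ h0; exists x'; rewrite x'E.
case: uL => [uL|[x]]; first by exists p'; rewrite p'E uL.
(* Lift [u] along [f] to a vector [z] on the line through [w p] and [v x]; it is a point of [A], and
   its image is kept by the simplification. *)
rewrite LE => /memv_addP[_ /vlineP[a ->] [_ /vlineP[b ->]]].
rewrite -!linearZ -linearD /=; set z := (_ + _)%R => uz.
have z0 : z != 0%R by apply: contraNneq u0 => z0; rewrite uz z0 linear0.
have [|y yz] := (pts z0).2.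
  by right; exists (val (val x)); rewrite memv_add ?memvZ ?memv_line.
have e := line_map f yz; rewrite uz -e; apply: exA.
by apply: line_neq0 (esym e); rewrite -uz.
Qed.

End Cone.

(** * Invariance of conings under isomorphism *)

Lemma isomorphic_simple (T U : finType) (M : matroid T) (N : matroid U) :
  isomorphic M N -> simple M -> simple N.
Proof.
case=> f [g gK fK] fM [nl np].
have loop_g y : loop N y = loop M (g y).
  by rewrite /loop -fM imset_set1 fK.
split=> [y|x y]; first by rewrite loop_g.
rewrite /parallel !loop_g => h; apply: (can_inj fK); apply: np.
by rewrite /parallel -fM imsetU1 imset_set1 !fK (can_eq fK).
Qed.

Lemma qconing_isomorphic (F : finFieldType) (T U V : finType)
    (N : matroid T) (A : matroid U) (P : matroid V) :
  qconing F N A -> isomorphic A P -> qconing F N P.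
Proof.
move=> [sN sA [n [v [w [p [rv rw tip pts]]]]]] AP.
split=> //; first exact: isomorphic_simple AP sA.
case: AP => f [g gK fK] fA.
exists n, v, (w \o g), (f p); split=> //=; rewrite ?gK //.
  move=> B; rewrite free_sp -sp_imset; last exact: can_inj fK.
  rewrite -(card_imset B (can_inj fK)) -(indep_dim rw) -fA -imset_comp.
  by rewrite (eq_imset B fK) imset_id.
move=> u u0; apply: iff_trans (pts u u0); split=> [[y yu]|[y yu]]; first by exists (g y).
by exists (f y); rewrite gK.
Qed.

(** * Stability of the coning closure under each minor operation *)

Section Closure.
Variables (F : finFieldType) (K : matroid_class).
Hypothesis K_closed : induced_minor_closed K.

(** Only the outermost coning has to be transported; its base stays the same. *)
Lemma coning_closure_iso (T U : finType) (M : matroid T) (N : matroid U) :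
  coning_closure F K M -> isomorphic M N -> coning_closure F K N.
Proof.
case=> [{}T {}M KM|T' {}T L {}M KL LM] MN.
  by apply/ConingClosure_base/(K_closed KM)/InducedMinor_iso/MN/InducedMinor_refl.
exact/(ConingClosure_cone KL)/qconing_isomorphic/MN.
Qed.

(** Absorbs the two alternatives left by [cone_restrict] and [cone_contract]. *)
Lemma coning_closure_lift (T U : finType) (M : matroid T) (N : matroid U) :
  coning_closure F K M -> qconing F M N \/ isomorphic M N ->
  coning_closure F K N.
Proof.
by move=> KM [/(ConingClosure_cone KM)|/(coning_closure_iso KM)].
Qed.

Lemma coning_closure_restrict (T : finType) (M : matroid T) (X : {set T}) :
  coning_closure F K M -> flat M X -> coning_closure F K (restrict M X).
Proof.
(* The induction generalizes over [X], since the base is restricted to the shadow of the given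
   flat. *)
move=> KM; elim: KM X => {T M} [T M KM|T U N A _ IH].
  move=> X fX; apply/ConingClosure_base/(K_closed KM).
  exact/InducedMinor_restrict/fX/InducedMinor_refl.
move=> [sN sA [n [v [w [p [rv rw tip pts]]]]]] X.
move=> /(cone_restrict sN sA rv rw tip pts)[Y fY].
exact/coning_closure_lift/IH.
Qed.

Lemma coning_closure_contract (T : finType) (M : matroid T) (C : {set T})
    (X : {set {x | x \notin C}}) :
  coning_closure F K M -> simplifying_set (contract M C) X ->
  coning_closure F K (restrict (contract M C) X).
Proof.
move=> KM; elim: KM C X => {T M} [T M KM|T U N A _ IH].
  move=> C X sX; apply/ConingClosure_base/(K_closed KM).
  exact/InducedMinor_contract/sX/InducedMinor_refl.
move=> [sN sA [n [v [w [p [rv rw tip pts]]]]]] C X.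
move=> /(cone_contract sN sA rv rw tip pts)[D [Y [sY]]].
exact/coning_closure_lift/IH.
Qed.

End Closure.

Theorem theorem1p5 (q : nat) (q_pp : prime_power q)
    (F : finFieldType) (cardF : #|F| = q)
    (K : matroid_class)
    (K_simple : forall (T : finType) (M : matroid T), K T M -> simple M)
    (K_repr : forall (T : finType) (M : matroid T), K T M -> representable F M)
    (K_closed : induced_minor_closed K) :
  induced_minor_closed (fun T : finType => @coning_closure F K T).
Proof.
move=> T U M N KM; elim=> {U N} [|U V N P _ KN|U N X _ KN|U N C X _ KN] //.
- exact: coning_closure_iso.
- exact: coning_closure_restrict.
exact: coning_closure_contract.
Qed.
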